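(* Let $Q:\mathcal{S}\times\mathcal{A}\to\mathbb{R}$ be a twice continuously differentiable function, and let $a^*(s)=\arg\max_{a}Q(s,a)$. Assume that for a given state $s$, $a^*(s)$ corresponds to a strict local maximum (of $Q(s,\cdot)$) and is an interior point of $\mathcal{A}$, such that the action Hessian $\nabla^2_{aa}Q(s,a^*(s))$ is negative definite. Then the sensitivity of the optimal action with respect to the state, denoted by the policy Jacobian $J_\pi(s)=\nabla_s a^*(s)$, is given by $$J_\pi(s) = -\left[\nabla^2_{aa}Q(s,a^*(s))\right]^{-1}\nabla^2_{sa}Q(s,a^*(s)).$$
   Context: $\mathcal{S}$ and $\mathcal{A}$ are the continuous state and action spaces of a Markov decision process (state vectors $s$ of dimension $k$, action vectors $a$ of dimension $d$), and $Q$ is a (parameterized) action-value function, the critic. The map $s\mapsto a^*(s)=\arg\max_a Q(s,a)$ is the greedy policy induced by $Q$. $\nabla^2_{aa}Q(s,a)\in\mathbb{R}^{d\times d}$ is the Hessian of $Q$ in the action variable, with entries $\partial^2 Q/\partial a_i\partial a_j$. $\nabla^2_{sa}Q(s,a)\in\mathbb{R}^{d\times k}$ is the mixed state-action Hessian, i.e. the Jacobian with respect to $s$ of the action gradient $\nabla_a Q(s,a)$, with entries $\partial^2 Q/\partial a_i\partial s_j$. $\nabla_s a^*(s)$ is the $d\times k$ Jacobian matrix with entries $\partial a^*_i/\partial s_j$.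
   Formalization: The map a* is additionally assumed continuous at the given state s (without this its Jacobian need not exist, as the maximizer can jump away), and s is taken interior to the state space; differentiability of a* at s is then proved. *)

(* Defs.v *)
(* MathComp-Analysis, over an arbitrary R : realType. *)
From HB Require Import structures.
From mathcomp Require Import all_boot all_order all_algebra.
From mathcomp Require Import all_classical all_reals all_analysis.

Set Implicit Arguments.
Unset Strict Implicit.
Unset Printing Implicit Defensive.

Import Order.TTheory GRing.Theory Num.Theory.
Import numFieldNormedType.Exports.

Local Open Scope classical_set_scope.
Local Open Scope ring_scope.

(* For V of finite dimension, which is how it is used: Df is differentiable
   iff each x |-> Df(x)(u) = 'D_u f x is, and D^2 f is continuous iff each
   'D_v ('D_u f) is. *)
Definition C2_on (R : realType) (V : normedModType R) (O : set V) (f : V -> R)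
    : Prop :=
  [/\ forall x, O x -> differentiable f x,
      forall u x, O x -> differentiable ('D_u f) x
    & forall u v x, O x -> {for x, continuous ('D_v ('D_u f))}].

Definition argmax (R : realType) (V : Type) (A : set V) (f : V -> R) : set V :=
  [set a | A a /\ forall b, A b -> f b <= f a].

Definition strict_local_max (R : realType) (V : normedModType R) (A : set V)
    (f : V -> R) (a : V) : Prop :=
  A a /\ \forall b \near a^', A b -> f b < f a.

(* Symmetry is not required here: it is automatic for the Hessian of a C^2
   function. *)
Definition negative_definite (R : realType) (n : nat) (H : 'M[R]_n) : Prop :=
  forall x : 'cV[R]_n, x != 0 -> (x^T *m H *m x) 0 0 < 0.

Definition basis_vec (R : realType) (n : nat) (i : 'I_n) : 'rV[R]_n :=
  delta_mx 0 i.

Section critic.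
Context (R : realType) (k d : nat).
Implicit Types (Q : 'rV[R]_k * 'rV[R]_d -> R) (s : 'rV[R]_k) (a : 'rV[R]_d).

Definition action_grad Q s a : 'rV[R]_d :=
  \row_(i < d) 'D_(basis_vec R i) (fun b => Q (s, b)) a.

Definition action_hessian Q s a : 'M[R]_d :=
  \matrix_(i < d, j < d)
    'D_(basis_vec R j) (fun b => action_grad Q s b 0 i) a.

Definition mixed_hessian Q s a : 'M[R]_(d, k) :=
  \matrix_(i < d, j < k)
    'D_(basis_vec R j) (fun t => action_grad Q t a 0 i) s.

(* The library's Jacobian 'J f s acts on row vectors from the right,
   'd f s h = h *m 'J f s, so its (j, i) entry is the derivative of the i-th
   component of f in the j-th direction; the transpose gives the d x k matrix. *)
Definition policy_jacobian (pi : 'rV[R]_k -> 'rV[R]_d) s : 'M[R]_(d, k) :=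
  (jacobian pi s)^T.

End critic.

(* Main.v *)
Require Import Defs.
From HB Require Import structures.
From mathcomp Require Import all_boot all_order all_algebra.
From mathcomp Require Import all_classical all_reals all_analysis.
From mathcomp Require Import lra.

Set Implicit Arguments.
Unset Strict Implicit.
Unset Printing Implicit Defensive.

Import Order.TTheory GRing.Theory Num.Theory.
Import numFieldNormedType.Exports.

Local Open Scope classical_set_scope.
Local Open Scope ring_scope.

(* The action gradient G = grad_a Q vanishes along the graph of astar near s, by
   the first-order condition at an interior maximum. Linearizing G at
   (s, astar s) gives M h + H w = o(|h| + |w|) for h = t - s and
   w = astar t - astar s, where w -> 0 by continuity. As H is invertible,
   |w + H^-1 M h| <= c (|h| + |w|) with c arbitrarily small, hence |w| = O(|h|)
   and w = - H^-1 M h + o(|h|). No existence part of the implicit function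
   theorem is needed, since astar is given. *)

(** * Partial derivatives as directional derivatives on the product *)

Lemma slope_pairl (R : realType) (V W U : normedModType R) (f : V * W -> U)
    (s v : V) (a : W) :
  (fun h : R => h^-1 *: (((fun t => f (t, a)) \o shift s) (h *: v) - f (s, a)))
  = (fun h => h^-1 *: ((f \o shift (s, a)) (h *: (v, 0)) - f (s, a))).
Proof.
apply/funext => h /=; congr (_ *: (f _ - _)).
by congr pair; rewrite /= scaler0 add0r.
Qed.

Lemma derive_pairl (R : realType) (V W U : normedModType R) (f : V * W -> U)
    (s v : V) (a : W) :
  'D_v (fun t => f (t, a)) s = 'D_(v, 0) f (s, a).
Proof. by rewrite /derive slope_pairl. Qed.

(** Working with the difference quotients themselves lets both the value and the existence of the
    partial derivative transfer by rewriting. *)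
Lemma slope_pairr (R : realType) (V W U : normedModType R) (f : V * W -> U)
    (s : V) (a w : W) :
  (fun h : R => h^-1 *: (((fun b => f (s, b)) \o shift a) (h *: w) - f (s, a)))
  = (fun h => h^-1 *: ((f \o shift (s, a)) (h *: (0, w)) - f (s, a))).
Proof.
apply/funext => h /=; congr (_ *: (f _ - _)).
by congr pair; rewrite /= scaler0 add0r.
Qed.

Lemma derive_pairr (R : realType) (V W U : normedModType R) (f : V * W -> U)
    (s : V) (a w : W) :
  'D_w (fun b => f (s, b)) a = 'D_(0, w) f (s, a).
Proof. by rewrite /derive slope_pairr. Qed.

Lemma derivable_pairr (R : realType) (V W U : normedModType R) (f : V * W -> U)
    (s : V) (a w : W) :
  derivable (fun b => f (s, b)) a w = derivable f (s, a) (0, w).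
Proof. by rewrite /derivable slope_pairr. Qed.

(** * First-order condition at an interior maximum *)

(** If the derivative [D] were nonzero, an expansion with error at most [|D| / 2 * |h|] and
    maximality would give [h * D <= |D| / 2 * |h|] for small [h] of either sign, which is absurd. *)
Lemma derive_local_max_eq0 (R : realType) (V : normedModType R) (f : V -> R)
    (a v : V) :
  derivable f a v -> (\forall b \near a, f b <= f a) -> 'D_v f a = 0.
Proof.
move=> /derivable_nbhs/eqaddoP df fmax; apply/eqP; apply: contraT => D0.
have {}fmax : \forall h \near (0 : R), f (h *: v + a) <= f a.
  have : (fun h : R => h *: v + a) @ (0 : R) --> a.
    rewrite -[X in _ --> X]add0r -(scale0r v).
    by apply: cvgD; [exact: scalel_continuous|exact: cvg_cst].
  by move=> /(_ _ fmax).
have : 0 < `|'D_v f a| / 2 by rewrite divr_gt0 ?normr_gt0.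
move=> /df dfa.
have [r /= r0 rP] := (nbhs_ballP _ _).1 (filterI fmax dfa : nbhs (0 : R) _).
have r2 : 0 < r / 2 by rewrite divr_gt0.
have r2r : r / 2 < r by rewrite ltr_pdivrMr // mulr_natr mulr2n ltrDl.
have bnd h : `|h| = r / 2 -> h * 'D_v f a <= `|'D_v f a| / 2 * (r / 2).
  move=> hr; have /rP[] : ball (0 : R) r h.
    by rewrite -ball_normE /= sub0r normrN hr.
  move=> /= fh.
  rewrite -!fctE /= !fctE hr distrC => /(le_trans (ler_norm _)).
  lra.
have := bnd (r / 2); rewrite gtr0_norm // => /(_ erefl).
have := bnd (- (r / 2)); rewrite normrN gtr0_norm // => /(_ erefl) h1 h2.
have : `|r / 2 * 'D_v f a| <= `|'D_v f a| / 2 * (r / 2).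
  by rewrite ler_norml h2 andbT lerNl -mulNr.
rewrite normrM (gtr0_norm r2) mulrC ler_pM2r //.
have := D0; rewrite -normr_gt0; lra.
Qed.

Lemma derive_argmax_eq0 (R : realType) (V W : normedModType R)
    (S : set V) (A : set W) (Q : V * W -> R) (t : V) (a w : W) :
  differentiable Q (t, a) -> (S `*` A)° (t, a) ->
  argmax A (fun b => Q (t, b)) a -> 'D_(0, w) Q (t, a) = 0.
Proof.
move=> Qdiff SAta [_ amax]; rewrite -derive_pairr.
apply: derive_local_max_eq0.
  by rewrite derivable_pairr; exact: diff_derivable.
have slice : (fun b => (t, b)) @ a --> (t, a).
  exact: (cvg_pair (cvg_cst t) (@cvg_id _ (nbhs a))).
have : \forall b \near a, (S `*` A) (t, b) by exact: slice SAta.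
by apply: filterS => b [_ /amax].
Qed.

(** * Row vectors and matrices *)

Lemma differentiable_row (R : realType) (V : normedModType R) (n : nat)
    (f : 'I_n -> V -> R) (x : V) :
  (forall i, differentiable (f i) x) ->
  differentiable (fun y => \row_(i < n) f i y) x.
Proof.
move=> df.
have -> : (fun y => \row_i f i y) =
    \sum_(i < n) (fun y => f i y *: (delta_mx 0 i : 'rV[R]_n)).
  apply/funext => y; rewrite fct_sumE [LHS]row_sum_delta.
  by apply: eq_bigr => i _; rewrite mxE.
by apply: differentiable_sum => i; apply: differentiableZl.
Qed.

Lemma mulmxr_continuous (R : realType) (m n p : nat) (B : 'M[R]_(n, p)) :
  continuous (mulmxr B : 'M[R]_(m, n) -> 'M[R]_(m, p)).
Proof.
have -> : (mulmxr B : 'M[R]_(m, n) -> 'M[R]_(m, p)) =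
    (fun A => \sum_i \sum_j \sum_l A i l *: (B l j *: delta_mx i j)).
  apply/funext => A; rewrite /= {1}[A *m B]matrix_sum_delta.
  apply: eq_bigr => i _; apply: eq_bigr => j _; rewrite mxE scaler_suml.
  by apply: eq_bigr => l _; rewrite scalerA.
apply: continuous_big => [|i _]; first exact: add_continuous.
apply: continuous_big => [|j _]; first exact: add_continuous.
apply: continuous_big => [|l _]; first exact: add_continuous.
by move=> A; exact: cvgZr_tmp (@coord_continuous _ _ _ i l A).
Qed.

(** A nonzero kernel vector would make the quadratic form vanish; row kernels of [H^T] are the
    column kernels of [H]. *)
Lemma negative_definite_unitmx (R : realType) (n : nat) (H : 'M[R]_n) :
  negative_definite H -> H \in unitmx.
Proof.
move=> Hneg; rewrite -unitmx_tr -row_free_unit -kermx_eq0.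
apply/negPn/negP => /rowV0Pn[v /sub_kermxP vH v0].
have vT0 : v^T != 0.
  by apply: contra v0 => /eqP vT; rewrite -(trmxK v) vT trmx0.
have := Hneg _ vT0; rewrite -mulmxA -[H *m _]trmxK trmx_mul trmxK vH.
by rewrite trmx0 mulmx0 mxE ltxx.
Qed.

(** * Differentiating an implicitly defined map *)

(** The bound with [C] is a quantitative form of injectivity of the partial differential along [W];
    the candidate [df] is characterized by its graph lying in the kernel of ['d G]. *)
Lemma littleo_implicit_linearization (R : realType) (V W : normedModType R)
    (G : V * W -> W) (f : V -> W) (df : {linear V -> W}) (s : V) (C : R) :
  continuous df -> 0 < C ->
  (forall w, `|w| <= C * `|'d G (s, f s) (0, w)|) ->
  (forall h, 'd G (s, f s) (h, df h) = 0) ->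
  differentiable G (s, f s) -> {for s, continuous f} ->
  (\forall t \near s, G (t, f t) = G (s, f s)) ->
  f \o shift s = cst (f s) + df +o_ 0 id.
Proof.
move=> dfc C0 Cle dG0 Gdiff fc Gcst.
have [K K0 Kle] := linear_lipschitz dfc.
apply/eqaddoP => _/posnumP[eps].
(* Absorption will give [|w| <= (2 * K + 1) * |h|], so [D] bounds [|h| + |w|] relative to [|h|], and
   [c * D <= eps] closes the estimate. *)
pose D : R := 2 * K + 2.
have D0 : 0 < D by rewrite /D addr_gt0 // mulr_gt0.
pose c : R := Num.min 2^-1 (eps%:num / D).
have c_gt0 : 0 < c by rewrite lt_min invr_gt0 ltr0n divr_gt0.
(* The division by [C] offsets the factor [C] lost when inverting the partial differential. *)
have /diff_locally/eqaddoP/(_ (c / C)) := Gdiff.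
rewrite divr_gt0 // => /(_ isT) Gr.
have fs : (fun h => (h, f (h + s) - f s)) @ (0 : V) --> ((0, 0) : V * W).
  apply: cvg_pair; first exact: cvg_id.
  have -> : (0 : W) = f s - f s by rewrite subrr.
  apply: cvgB; last exact: cvg_cst.
  rewrite -[X in X --> _]/((f \o shift s) @ (0 : V)) cvg_comp_shift add0r.
  exact: fc.
have {}Gcst : \forall h \near (0 : V), G (h + s, f (h + s)) = G (s, f s).
  move: Gcst; rewrite (near_shift 0 s) /= subr0; exact: filterS.
have {fs}Gr := fs _ Gr.
near=> h.
have Gh : G (h + s, f (h + s)) = G (s, f s) by near: h.
have : `|(G \o shift (s, f s) - (cst (G (s, f s)) + 'd G (s, f s)))
  (h, f (h + s) - f s)| <= c / C * `|(h, f (h + s) - f s)| by near: h.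
rewrite addrfctE opprfctE addrfctE /=.
rewrite addrfctE opprfctE addrfctE /=.
set w := f (h + s) - f s.
have -> : (h, w) + (s, f s) = (h + s, f (h + s)).
  by congr (_, _); rewrite /w /= subrK.
rewrite Gh opprD addrA subrr sub0r normrN.
(* Subtracting the kernel vector [(h, df h)] leaves a pure [W]-direction, where [Cle] applies. *)
have -> : 'd G (s, f s) (h, w) = 'd G (s, f s) (0, w - df h).
  rewrite -[RHS]addr0 -(dG0 h) -linearD; congr ('d G (s, f s) _).
  by congr (_, _); rewrite /= ?add0r ?subrK.
move=> dGw.
rewrite opprD addrA -/w.
(* The remainder bound first absorbs half of |w| (c <= 1/2), which makes w a
   big-O of h; only then is it a little-o of h. *)
have wdf : `|w - df h| <= c * `|(h, w)|.
  apply: le_trans (Cle _) _.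
  by rewrite -ler_pdivlMl // mulrA (mulrC C^-1) (le_trans dGw).
have hw : `|(h, w)| <= `|h| + `|w|.
  rewrite -[leLHS]/(Num.max `|h| `|w|) ge_max lerDl lerDr.
  by rewrite !normr_ge0.
have c2 : c <= 2^-1 by rewrite ge_min lexx.
have cD : c * D <= eps%:num by rewrite -ler_pdivlMr // ge_min lexx orbT.
have wle : `|w| <= `|w - df h| + K * `|h|.
  by rewrite -{1}(subrK (df h) w) (le_trans (ler_normD _ _)) // lerD2l.
have nh := normr_ge0 h; have nw := normr_ge0 w.
have {}wle : `|w| <= (2 * K + 1) * `|h|.
  have : c * `|(h, w)| <= 2^-1 * (`|h| + `|w|) by rewrite ler_pM // ltW.
  lra.
apply: le_trans wdf _; apply: le_trans (_ : c * D * `|h| <= _); last first.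
  exact: ler_wpM2r.
rewrite -mulrA ler_wpM2l ?(ltW c_gt0) //.
have DhE : D * `|h| = 2 * (K * `|h|) + 2 * `|h| by rewrite /D mulrDl mulrA.
have : (2 * K + 1) * `|h| = 2 * (K * `|h|) + `|h| by rewrite mulrDl mulrA mul1r.
move=> KhE; rewrite KhE in wle; apply: (le_trans hw); rewrite DhE; lra.
Unshelve. all: by end_near. Qed.

Lemma diff_implicit (R : realType) (V W : normedModType R)
    (G : V * W -> W) (f : V -> W) (df : {linear V -> W}) (s : V) (C : R) :
  continuous df -> 0 < C ->
  (forall w, `|w| <= C * `|'d G (s, f s) (0, w)|) ->
  (forall h, 'd G (s, f s) (h, df h) = 0) ->
  differentiable G (s, f s) -> {for s, continuous f} ->
  (\forall t \near s, G (t, f t) = G (s, f s)) ->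
  is_diff s f df.
Proof.
move=> dfc C0 Cle dG0 Gdiff fc Gcst.
have fdf := littleo_implicit_linearization dfc C0 Cle dG0 Gdiff fc Gcst.
have dE := diff_unique dfc fdf.
by apply: DiffDef => //; apply/diff_locallyP; rewrite dE.
Qed.

(** This reduces the differential of the action gradient to its values on basis vectors, which are
    the Hessian entries. *)
Lemma linear_pair_rowE (R : pzRingType) (k d : nat) (U : lmodType R)
    (g : {linear ('rV[R]_k * 'rV[R]_d)%type -> U}) (h : 'rV[R]_k)
    (w : 'rV[R]_d) :
  g (h, w) = \sum_j h 0 j *: g (delta_mx 0 j, 0)
           + \sum_j w 0 j *: g (0, delta_mx 0 j).
Proof.
have -> : (h, w) =
    \sum_j h 0 j *: ((delta_mx 0 j, 0) : ('rV[R]_k * 'rV[R]_d)%type)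
    + \sum_j w 0 j *: ((0, delta_mx 0 j) : ('rV[R]_k * 'rV[R]_d)%type).
  rewrite [LHS]surjective_pairing [RHS]surjective_pairing /=.
  rewrite !raddf_sum /=.
  rewrite [in LHS](row_sum_delta h) [in LHS](row_sum_delta w).
  congr (_, _).
    by rewrite [X in _ + X]big1 ?addr0 // => i _; rewrite scaler0.
  by rewrite [X in X + _]big1 ?add0r // => i _; rewrite scaler0.
rewrite linearD !linear_sum; congr (_ + _);
by apply: eq_bigr => j _; rewrite linearZ.
Qed.

(* Continuity of astar at s is implicit in the existence of its Jacobian there.
   It cannot be dropped: with one-dimensional state and action spaces, take
   Q(s, a) = - a^2 / (1 + a^2) + 2 phi(a - 1 / s), the second term read as 0
   when s = 0, where phi is a smooth bump supported in [-1/2, 1/2] with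
   maximum 1. Q is smooth, astar(0) = 0 satisfies the other hypotheses, and
   astar is unbounded near 0. *)
Theorem lemma4p1 (R : realType) (k d : nat)
    (S : set 'rV[R]_k) (A : set 'rV[R]_d)
    (Q : 'rV[R]_k * 'rV[R]_d -> R)
    (HQ : C2_on (S `*` A)° Q)
    (astar : 'rV[R]_k -> 'rV[R]_d)
    (Hastar : forall t, S t -> argmax A (fun a => Q (t, a)) (astar t))
    (s : 'rV[R]_k) (Hs : S° s)
    (Hcont : {for s, continuous astar})
    (Hmax : strict_local_max A (fun a => Q (s, a)) (astar s))
    (Hint : A° (astar s))
    (Hneg : negative_definite (action_hessian Q s (astar s))) :
  differentiable astar s /\
  policy_jacobian astar s
    = - invmx (action_hessian Q s (astar s)) *m mixed_hessian Q s (astar s).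
Proof.
pose G (x : ('rV[R]_k * 'rV[R]_d)%type) : 'rV[R]_d :=
  \row_(i < d) 'D_(0, basis_vec R i) Q x.
set a := astar s in Hmax Hint Hneg *.
set H := action_hessian Q s a in Hneg *; set M := mixed_hessian Q s a.
have [Qdiff DQdiff _] := HQ.
have gradE t b i : action_grad Q t b 0 i = 'D_(0, basis_vec R i) Q (t, b).
  by rewrite mxE derive_pairr.
have SA : nbhs (s, a) (S `*` A)° by apply: nbhs_interior; exists (S, A).
have SAsa : (S `*` A)° (s, a) := nbhs_singleton SA.
have DQdiffsa i : differentiable ('D_(0, basis_vec R i) Q) (s, a).
  exact: DQdiff.
have Gdiff : differentiable G (s, a) by exact: differentiable_row.
(* The transposes come from vectors being rows, on which matrices act from the right. *)
have dGE h w : 'd G (s, a) (h, w) = h *m M^T + w *m H^T.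
  rewrite -deriveE // derive_mx; last exact: diff_derivable.
  apply/rowP => i; rewrite !mxE.
  have -> : (fun x => G x 0 i) = 'D_(0, basis_vec R i) Q.
    by apply/funext => x; rewrite mxE.
  rewrite deriveE // linear_pair_rowE; congr (_ + _); apply: eq_bigr => j _.
    rewrite !mxE.
    have -> : (fun t => action_grad Q t a 0 i) =
        (fun t => 'D_(0, basis_vec R i) Q (t, a)) by apply/funext.
    by rewrite (derive_pairl ('D_(0, basis_vec R i) Q) s _ a) deriveE.
  rewrite !mxE.
  have -> : (fun b => action_grad Q s b 0 i) =
      (fun b => 'D_(0, basis_vec R i) Q (s, b)) by apply/funext.
  by rewrite (derive_pairr ('D_(0, basis_vec R i) Q) s a) deriveE.
have HT : H^T \in unitmx by rewrite unitmx_tr negative_definite_unitmx.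
have graph_cvg : (fun t => (t, astar t)) @ s --> (s, a).
  exact: (cvg_pair (@cvg_id _ (nbhs s)) Hcont).
(* Continuity of [astar] keeps the graph in the interior of [S * A] near [s], so the first-order
   condition holds at every nearby [t]. *)
have G0 : \forall t \near s, G (t, astar t) = 0.
  have near_SA := graph_cvg (S `*` A)° SA.
  rewrite nbhs_simpl /= in near_SA.
  apply: filterS near_SA => t tSA.
  have [St _] : (S `*` A) (t, astar t) := interior_subset tSA.
  apply/rowP => i; rewrite mxE [RHS]mxE.
  apply: (@derive_argmax_eq0 R _ _ S A Q t (astar t)) => //; first exact: Qdiff.
  exact: Hastar.
(* Solution [w] of [h *m M^T + w *m H^T = 0]. *)
pose df : {linear 'rV[R]_k -> 'rV[R]_d} := mulmxr (- (M^T *m invmx H^T)).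
(* Applied to [w *m H^T], this Lipschitz bound for the inverse yields the required lower bound on
   the partial differential. *)
have [C C0 Cle] := linear_lipschitz (@mulmxr_continuous R 1 _ _ (invmx H^T)).
have astar_diff : is_diff s astar df.
  apply: (@diff_implicit _ _ _ G _ df s C) => //.
  - exact: mulmxr_continuous.
  - by move=> w; rewrite dGE mul0mx add0r -{1}(mulmxK HT w) Cle.
  - by move=> h; rewrite dGE /= mulmxN mulNmx mulmxA mulmxKV // subrr.
  - have Gs : G (s, astar s) = 0 := nbhs_singleton G0.
    by apply: filterS G0 => t ->.
split; first exact: ex_diff.
rewrite /policy_jacobian -[RHS]trmxK; congr trmx.
apply/row_matrixP => i; rewrite !rowE /jacobian mul_rV_lin1 diff_val /=.
by congr mulmx; rewrite trmx_mul linearN /= trmx_inv mulmxN.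
Qed.
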